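(* Let $\omega$ be a push-out non-expansive and composition sub-additive valuation on an Abelian category $\mathcal{M}$. (1) Let $S$ be a finite set with $n$ elements. The direct sum functor $\oplus\colon\mathrm{Fun}(S,\mathcal{M})\to\mathcal{M}$, given on morphisms by $(f_s)_{s\in S}\mapsto\bigoplus_{s\in S}f_s$, induces a $1$-Lipschitz function on objects with respect to the distances $d_\omega$; that is, $d_\omega\bigl(\bigoplus_{s}X_s,\bigoplus_{s}Y_s\bigr)\le d_\omega\bigl((X_s)_{s\in S},(Y_s)_{s\in S}\bigr)$ for all objects $(X_s)_{s\in S}$, $(Y_s)_{s\in S}$ of $\mathrm{Fun}(S,\mathcal{M})$. (2) The cokernel functor $\mathrm{coker}\colon\mathrm{Fun}([1],\mathcal{M})\to\mathcal{M}$, given on morphisms by $(\varphi_0,\varphi_1)\mapsto\mathrm{coker}(\varphi_0,\varphi_1)$, induces a $1$-Lipschitz function on objects with respect to the distances $d_\omega$; that is, $d_\omega(\mathrm{coker}(f),\mathrm{coker}(g))\le d_\omega(f,g)$ for all objects $f,g$ of $\mathrm{Fun}([1],\mathcal{M})$.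
   Context: A valuation on an Abelian category $\mathcal{A}$ is a function $\omega\colon\mathrm{mor}(\mathcal{A})\to[0,\infty]$ such that (1) $\omega(f)=0$ whenever $f$ is an isomorphism, and (2) $\omega(0\colon X\to Y)=\omega(0\colon Y\to X)$ for all objects $X,Y$. The associated distance is $d_\omega(X,Y):=\inf\sum_i\omega(f_i)$, the infimum over all finite zig-zags $X=W_0\xrightarrow{f_1}W_1\xleftarrow{f_2}W_2\xrightarrow{f_3}\cdots\xleftarrow{f_l}W_l=Y$ of arbitrary length in $\mathcal{A}$. $\omega$ is push-out non-expansive if $\omega(f)\ge\omega(g)$ for every push-out square with top $f\colon X_0\to X_1$, bottom $g\colon Y_0\to Y_1$ and vertical morphisms $X_0\to Y_0$, $X_1\to Y_1$. It is composition sub-additive if $\omega(gf)\le\omega(f)+\omega(g)$ for all composable $f,g$. For a finite set $S$ viewed as a discrete category, $\mathrm{Fun}(S,\mathcal{M})$ is the functor category, with objects the families $(X_s)_{s\in S}$ and morphisms the families $(f_s)_{s\in S}$. A valuation $\omega$ on $\mathcal{M}$ gives a valuation on $\mathrm{Fun}(S,\mathcal{M})$, also denoted $\omega$, by $\omega((f_s)_{s\in S}):=\sum_{s\in S}\omega(f_s)$. $[1]$ is the poset category $0\le 1$. Objects of $\mathrm{Fun}([1],\mathcal{M})$ are morphisms $f\colon X_0\to X_1$ of $\mathcal{M}$, and morphisms from $f\colon X_0\to X_1$ to $g\colon Y_0\to Y_1$ are pairs $(\varphi_0\colon X_0\to Y_0,\varphi_1\colon X_1\to Y_1)$ with $g\varphi_0=\varphi_1f$;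 $\mathrm{coker}(\varphi_0,\varphi_1)\colon\mathrm{coker}(f)\to\mathrm{coker}(g)$ is the induced morphism. A valuation $\omega$ on $\mathcal{M}$ gives a valuation on $\mathrm{Fun}([1],\mathcal{M})$, also denoted $\omega$, by $\omega(\varphi_0,\varphi_1):=\omega(\varphi_0)+\omega(\varphi_1)$. In each of these categories $d_\omega$ is the distance associated with the respective valuation. *)

(* Defs.v *)
From mathcomp Require Import all_boot all_order all_algebra.
From mathcomp Require Import boolp classical_sets reals.
From mathcomp Require Import constructive_ereal ereal.

Set Implicit Arguments.
Unset Strict Implicit.
Unset Printing Implicit Defensive.

Import Order.TTheory GRing.Theory Num.Theory.

Declare Scope cat_scope.
Delimit Scope cat_scope with cat.
Local Open Scope cat_scope.
Local Open Scope classical_set_scope.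
Local Open Scope ereal_scope.

Record category := Category {
  ob :> Type;
  mor : ob -> ob -> Type;
  idm : forall X : ob, mor X X;
  compm : forall X Y Z : ob, mor Y Z -> mor X Y -> mor X Z;
  compmA : forall (W X Y Z : ob) (h : mor Y Z) (g : mor X Y) (f : mor W X),
    compm h (compm g f) = compm (compm h g) f;
  comp1m : forall (X Y : ob) (f : mor X Y), compm (idm Y) f = f;
  compm1 : forall (X Y : ob) (f : mor X Y), compm f (idm X) = f }.

Arguments mor {c}.
Arguments idm {c}.
Arguments compm {c X Y Z}.

Notation "g ∘ f" := (compm g f) (at level 40, left associativity) : cat_scope.

Record functor (C D : category) := Functor {
  fob :> C -> D;
  fmor : forall X Y : C, mor X Y -> mor (fob X) (fob Y);
  fmor1 : forall X : C, fmor (idm X) = idm (fob X);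
  fmorM : forall (X Y Z : C) (g : mor Y Z) (f : mor X Y),
    fmor (g ∘ f) = fmor g ∘ fmor f }.

Section CategoricalNotions.
Variable C : category.
Implicit Types X Y Z T : C.

Definition is_iso X Y (f : mor X Y) : Prop :=
  exists g : mor Y X, g ∘ f = idm X /\ f ∘ g = idm Y.

Definition is_mono X Y (f : mor X Y) : Prop :=
  forall T (a b : mor T X), f ∘ a = f ∘ b -> a = b.

Definition is_epi X Y (f : mor X Y) : Prop :=
  forall T (a b : mor Y T), a ∘ f = b ∘ f -> a = b.

Definition is_zero_object Z : Prop :=
  (forall X, exists! f : mor Z X, True) /\
  (forall X, exists! f : mor X Z, True).

Definition is_zero X Y (f : mor X Y) : Prop :=
  exists Z (g : mor Z Y) (h : mor X Z), is_zero_object Z /\ f = g ∘ h.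

Definition is_kernel K X Y (f : mor X Y) (k : mor K X) : Prop :=
  is_zero (f ∘ k) /\
  forall T (a : mor T X), is_zero (f ∘ a) -> exists! b : mor T K, k ∘ b = a.

Definition is_cokernel X Y Q (f : mor X Y) (q : mor Y Q) : Prop :=
  is_zero (q ∘ f) /\
  forall T (a : mor Y T), is_zero (a ∘ f) -> exists! b : mor Q T, b ∘ q = a.

Definition is_pushout X0 X1 Y0 Y1 (f : mor X0 X1) (g : mor Y0 Y1)
    (u0 : mor X0 Y0) (u1 : mor X1 Y1) : Prop :=
  u1 ∘ f = g ∘ u0 /\
  forall T (a : mor X1 T) (b : mor Y0 T), a ∘ f = b ∘ u0 ->
    exists! c : mor Y1 T, c ∘ u1 = a /\ c ∘ g = b.

Record is_biproduct (S : finType) (X : S -> C) (B : C)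
    (i : forall s, mor (X s) B) (p : forall s, mor B (X s)) : Prop :=
  IsBiproduct {
  biproduct_eq : forall s, p s ∘ i s = idm (X s);
  biproduct_neq : forall s t, s <> t -> is_zero (p t ∘ i s);
  biproduct_product : forall T (a : forall s, mor T (X s)),
    exists! b : mor T B, forall s, p s ∘ b = a s;
  biproduct_coproduct : forall T (a : forall s, mor (X s) T),
    exists! b : mor B T, forall s, b ∘ i s = a s }.

End CategoricalNotions.

(* Zero object, finite biproducts, kernels, cokernels, all monomorphisms and
   epimorphisms normal; the enrichment in abelian groups is a consequence.
   The direct sums and cokernels are chosen, so that they define functors, but
   the choice is an arbitrary part of the structure. *)
Record abelian_category := AbelianCategory {
  abcat :> category;
  zero_ob : abcat;
  zero_obP : is_zero_object zero_ob;
  dsum : forall S : finType, (S -> abcat) -> abcat;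
  dsum_inj : forall (S : finType) (X : S -> abcat) (s : S),
    mor (X s) (dsum X);
  dsum_proj : forall (S : finType) (X : S -> abcat) (s : S),
    mor (dsum X) (X s);
  dsumP : forall (S : finType) (X : S -> abcat),
    is_biproduct (@dsum_inj S X) (@dsum_proj S X);
  ker_exists : forall (X Y : abcat) (f : mor X Y),
    exists (K : abcat) (k : mor K X), is_kernel f k;
  coker : forall X Y : abcat, mor X Y -> abcat;
  coker_proj : forall (X Y : abcat) (f : mor X Y), mor Y (coker f);
  cokerP : forall (X Y : abcat) (f : mor X Y), is_cokernel f (coker_proj f);
  mono_normal : forall (X Y : abcat) (f : mor X Y), is_mono f ->
    exists (Z : abcat) (g : mor Y Z), is_kernel g f;
  epi_normal : forall (X Y : abcat) (f : mor X Y), is_epi f ->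
    exists (Z : abcat) (g : mor Z X), is_cokernel g f }.

Section Valuations.
Variable R : realType.

Record valuation (C : category) := Valuation {
  weight : forall X Y : C, mor X Y -> \bar R;
  weight_ge0 : forall (X Y : C) (f : mor X Y), 0 <= weight f;
  weight_iso : forall (X Y : C) (f : mor X Y), is_iso f -> weight f = 0;
  weight_zero : forall (X Y : C) (f : mor X Y) (g : mor Y X),
    is_zero f -> is_zero g -> weight f = weight g }.

Arguments weight {C} v {X Y}.

Definition pushout_nonexpansive (C : category) (w : valuation C) : Prop :=
  forall (X0 X1 Y0 Y1 : C) (f : mor X0 X1) (g : mor Y0 Y1)
    (u0 : mor X0 Y0) (u1 : mor X1 Y1),
  is_pushout f g u0 u1 -> weight w g <= weight w f.

Definition composition_subadditive (C : category) (w : valuation C) : Prop :=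
  forall (X Y Z : C) (f : mor X Y) (g : mor Y Z),
  weight w (g ∘ f) <= weight w f + weight w g.

(* [zigzag Y X] is the type of zig-zags X -> W1 <- W2 -> ... <- Y. *)
Inductive zigzag (C : category) (Y : C) : C -> Type :=
| ZZnil : zigzag Y Y
| ZZcons (X W X' : C) : mor X W -> mor X' W -> zigzag Y X' -> zigzag Y X.

Fixpoint zigzag_weight (C : category) (w : valuation C) (Y X : C)
    (z : zigzag Y X) : \bar R :=
  match z with
  | ZZnil => 0
  | ZZcons _ _ _ f g z' => weight w f + weight w g + zigzag_weight w z'
  end.

Definition dist (C : category) (w : valuation C) (X Y : C) : \bar R :=
  ereal_inf [set zigzag_weight w z | z in [set: zigzag Y X]].

Definition lipschitz1 (C D : category) (wC : valuation C) (wD : valuation D)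
    (F : functor C D) : Prop :=
  forall X Y : C, dist wD (F X) (F Y) <= dist wC X Y.

End Valuations.

Arguments weight {R C} v {X Y}.

Section ZeroMorphisms.
Variable C : category.
Implicit Types X Y Z : C.

Lemma is_zero_compl X Y Z (g : mor Y Z) (f : mor X Y) :
  is_zero f -> is_zero (g ∘ f).
Proof.
by move=> [O [a [b [hO ->]]]]; exists O, (g ∘ a), b; rewrite compmA.
Qed.

Lemma is_zero_compr X Y Z (g : mor Y Z) (f : mor X Y) :
  is_zero g -> is_zero (g ∘ f).
Proof.
by move=> [O [a [b [hO ->]]]]; exists O, a, (b ∘ f); rewrite compmA.
Qed.

Lemma is_zero_through Z X Y (f : mor X Y) : is_zero_object Z -> is_zero f ->
  exists (g : mor Z Y) (h : mor X Z), f = g ∘ h.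
Proof.
move=> [Z0 Z1] [O [a [b [[O0 O1] ->]]]].
have [u _] := Z0 O; have [v _] := Z1 O.
exists (a ∘ u), (v ∘ b); rewrite -compmA (compmA u v b).
have [e [_ he]] := O0 O.
by rewrite -(he (u ∘ v) I) (he (idm O) I) comp1m.
Qed.

End ZeroMorphisms.

Section FamilyCategory.
Variables (S : finType) (C : category).

Definition fam_mor (X Y : S -> C) : Type := forall s, mor (X s) (Y s).

Definition fam_id (X : S -> C) : fam_mor X X := fun s => idm (X s).

Definition fam_comp (X Y Z : S -> C) (g : fam_mor Y Z) (f : fam_mor X Y) :
  fam_mor X Z := fun s => g s ∘ f s.

Lemma fam_compA (W X Y Z : S -> C) (h : fam_mor Y Z) (g : fam_mor X Y)
    (f : fam_mor W X) :
  fam_comp h (fam_comp g f) = fam_comp (fam_comp h g) f.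
Proof. by apply: functional_extensionality_dep => s; exact: compmA. Qed.

Lemma fam_comp1m (X Y : S -> C) (f : fam_mor X Y) :
  fam_comp (@fam_id Y) f = f.
Proof. by apply: functional_extensionality_dep => s; exact: comp1m. Qed.

Lemma fam_compm1 (X Y : S -> C) (f : fam_mor X Y) :
  fam_comp f (@fam_id X) = f.
Proof. by apply: functional_extensionality_dep => s; exact: compm1. Qed.

Definition fam_cat : category := Category fam_compA fam_comp1m fam_compm1.

Lemma fam_zero_object (Z : C) :
  is_zero_object Z -> is_zero_object ((fun=> Z) : fam_cat).
Proof.
move=> [Z0 Z1]; split=> X.
  exists (fun s => projT1 (cid (Z0 (X s)))); split=> // g _.
  apply: functional_extensionality_dep => s.
  by case: cid => f [_ hf] /=; exact: hf.
exists (fun s => projT1 (cid (Z1 (X s)))); split=> // g _.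
apply: functional_extensionality_dep => s.
by case: cid => f [_ hf] /=; exact: hf.
Qed.

Lemma fam_is_zero (Z : C) (X Y : fam_cat) (f : mor X Y) :
  is_zero_object Z -> is_zero f -> forall s, is_zero (f s).
Proof.
move=> hZ /(is_zero_through (fam_zero_object hZ)) [g [h ->]] s.
by exists Z, (g s), (h s).
Qed.

End FamilyCategory.

Section FamilyValuation.
Variables (R : realType) (S : finType) (M : abelian_category).
Variable w : valuation R M.

Definition fam_weight (X Y : fam_cat S M) (f : mor X Y) : \bar R :=
  \sum_(s : S) weight w (f s).

Lemma fam_weight_ge0 (X Y : fam_cat S M) (f : mor X Y) : 0 <= fam_weight f.
Proof. by apply: sume_ge0 => s _; exact: weight_ge0. Qed.

Lemma fam_weight_iso (X Y : fam_cat S M) (f : mor X Y) :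
  is_iso f -> fam_weight f = 0.
Proof.
move=> [g [gf fg]]; apply: big1 => s _; apply: weight_iso.
exists (g s); split; first exact: (f_equal (@^~ s) gf).
exact: (f_equal (@^~ s) fg).
Qed.

Lemma fam_weight_zero (X Y : fam_cat S M) (f : mor X Y) (g : mor Y X) :
  is_zero f -> is_zero g -> fam_weight f = fam_weight g.
Proof.
move=> f0 g0; apply: eq_bigr => s _.
by apply: weight_zero; apply: (fam_is_zero (@zero_obP M)).
Qed.

Definition fam_valuation : valuation R (fam_cat S M) :=
  Valuation fam_weight_ge0 fam_weight_iso fam_weight_zero.

End FamilyValuation.

Section ArrowCategory.
Variable C : category.

Record arrow := Arrow { asrc : C; atgt : C; amap : mor asrc atgt }.

Record arrow_mor (f g : arrow) := ArrowMor {
  amor0 : mor (asrc f) (asrc g);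
  amor1 : mor (atgt f) (atgt g);
  amor_comm : amap g ∘ amor0 = amor1 ∘ amap f }.

Lemma arrow_mor_eq (f g : arrow) (p q : arrow_mor f g) :
  amor0 p = amor0 q -> amor1 p = amor1 q -> p = q.
Proof.
case: p q => [p0 p1 hp] [q0 q1 hq] /= e0 e1.
by case: _ / e0 in hq *; case: _ / e1 in hq *; rewrite (Prop_irrelevance hp hq).
Qed.

Lemma arrow_id_comm (f : arrow) :
  amap f ∘ idm (asrc f) = idm (atgt f) ∘ amap f.
Proof. by rewrite compm1 comp1m. Qed.

Definition arrow_id (f : arrow) : arrow_mor f f := ArrowMor (arrow_id_comm f).

Lemma arrow_comp_comm (f g h : arrow) (q : arrow_mor g h)
    (p : arrow_mor f g) :
  amap h ∘ (amor0 q ∘ amor0 p) = (amor1 q ∘ amor1 p) ∘ amap f.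
Proof. by rewrite compmA amor_comm -compmA amor_comm compmA. Qed.

Definition arrow_comp (f g h : arrow) (q : arrow_mor g h)
  (p : arrow_mor f g) : arrow_mor f h := ArrowMor (arrow_comp_comm q p).

Lemma arrow_compA (e f g h : arrow) (r : arrow_mor g h) (q : arrow_mor f g)
    (p : arrow_mor e f) :
  arrow_comp r (arrow_comp q p) = arrow_comp (arrow_comp r q) p.
Proof. by apply: arrow_mor_eq; exact: compmA. Qed.

Lemma arrow_comp1m (f g : arrow) (p : arrow_mor f g) :
  arrow_comp (arrow_id g) p = p.
Proof. by apply: arrow_mor_eq; exact: comp1m. Qed.

Lemma arrow_compm1 (f g : arrow) (p : arrow_mor f g) :
  arrow_comp p (arrow_id f) = p.
Proof. by apply: arrow_mor_eq; exact: compm1. Qed.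

Definition arrow_cat : category :=
  Category arrow_compA arrow_comp1m arrow_compm1.

Lemma arrow_zero_object (Z : C) :
  is_zero_object Z -> is_zero_object (Arrow (idm Z) : arrow_cat).
Proof.
move=> [Z0 Z1]; split; case=> X0 X1 f.
  have [a [_ ha]] := Z0 X0; have [b [_ hb]] := Z0 X1.
  have e : f ∘ a = b ∘ idm Z by rewrite -(hb (f ∘ a) I) compm1.
  exists (@ArrowMor (Arrow (idm Z)) (Arrow f) a b e); split=> // g _.
  by apply: arrow_mor_eq; [exact: ha|exact: hb].
have [a [_ ha]] := Z1 X0; have [b [_ hb]] := Z1 X1.
have e : idm Z ∘ a = b ∘ f by rewrite -(ha (b ∘ f) I) comp1m.
exists (@ArrowMor (Arrow f) (Arrow (idm Z)) a b e); split=> // g _.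
by apply: arrow_mor_eq; [exact: ha|exact: hb].
Qed.

Lemma arrow_is_zero (Z : C) (f g : arrow_cat) (p : mor f g) :
  is_zero_object Z -> is_zero p -> is_zero (amor0 p) /\ is_zero (amor1 p).
Proof.
move=> hZ /(is_zero_through (arrow_zero_object hZ)) [a [b ->]].
by split; [exists Z, (amor0 a), (amor0 b)|exists Z, (amor1 a), (amor1 b)].
Qed.

End ArrowCategory.

Section ArrowValuation.
Variables (R : realType) (M : abelian_category) (w : valuation R M).

Definition arrow_weight (f g : arrow_cat M) (p : mor f g) : \bar R :=
  weight w (amor0 p) + weight w (amor1 p).

Lemma arrow_weight_ge0 (f g : arrow_cat M) (p : mor f g) :
  0 <= arrow_weight p.
Proof. by apply: adde_ge0; exact: weight_ge0. Qed.

Lemma arrow_weight_iso (f g : arrow_cat M) (p : mor f g) :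
  is_iso p -> arrow_weight p = 0.
Proof.
move=> [q [qp pq]].
have p0_iso : is_iso (amor0 p).
  exists (amor0 q); split.
    exact: (f_equal (@amor0 _ _ _) qp).
  exact: (f_equal (@amor0 _ _ _) pq).
have p1_iso : is_iso (amor1 p).
  exists (amor1 q); split.
    exact: (f_equal (@amor1 _ _ _) qp).
  exact: (f_equal (@amor1 _ _ _) pq).
by rewrite /arrow_weight (weight_iso w p0_iso) (weight_iso w p1_iso) adde0.
Qed.

Lemma arrow_weight_zero (f g : arrow_cat M) (p : mor f g) (q : mor g f) :
  is_zero p -> is_zero q -> arrow_weight p = arrow_weight q.
Proof.
move=> /(arrow_is_zero (@zero_obP M)) [p0 p1].
move=> /(arrow_is_zero (@zero_obP M)) [q0 q1].
by rewrite /arrow_weight (weight_zero w p0 q0) (weight_zero w p1 q1).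
Qed.

Definition arrow_valuation : valuation R (arrow_cat M) :=
  Valuation arrow_weight_ge0 arrow_weight_iso arrow_weight_zero.

End ArrowValuation.

Section DirectSumFunctor.
Variables (S : finType) (M : abelian_category).

Definition dsum_mor (X Y : fam_cat S M) (f : mor X Y) :
    mor (dsum X) (dsum Y) :=
  projT1 (cid (biproduct_coproduct (dsumP X)
    (fun s => dsum_inj Y s ∘ f s))).

Lemma dsum_mor_inj (X Y : fam_cat S M) (f : mor X Y) (s : S) :
  dsum_mor f ∘ dsum_inj X s = dsum_inj Y s ∘ f s.
Proof. by rewrite /dsum_mor; case: cid => b [hb _] /=; exact: hb. Qed.

Lemma dsum_mor_uniq (X Y : fam_cat S M) (f : mor X Y)
    (b : mor (dsum X) (dsum Y)) :
  (forall s, b ∘ dsum_inj X s = dsum_inj Y s ∘ f s) -> dsum_mor f = b.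
Proof.
by move=> hb; rewrite /dsum_mor; case: cid => c [_ hc] /=; exact: hc.
Qed.

Lemma dsum_mor1 (X : fam_cat S M) : dsum_mor (idm X) = idm (dsum X).
Proof. by apply: dsum_mor_uniq => s; rewrite comp1m [RHS]compm1. Qed.

Lemma dsum_morM (X Y Z : fam_cat S M) (g : mor Y Z) (f : mor X Y) :
  dsum_mor (g ∘ f) = dsum_mor g ∘ dsum_mor f.
Proof.
apply: dsum_mor_uniq => s.
by rewrite -compmA dsum_mor_inj compmA dsum_mor_inj -compmA.
Qed.

Definition dsum_functor : functor (fam_cat S M) M :=
  @Functor (fam_cat S M) M (@dsum M S) dsum_mor dsum_mor1 dsum_morM.

End DirectSumFunctor.

Section CokernelFunctor.
Variable M : abelian_category.

Lemma coker_mor_ex (f g : arrow_cat M) (p : mor f g) :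
  exists! b : mor (coker (amap f)) (coker (amap g)),
    b ∘ coker_proj (amap f) = coker_proj (amap g) ∘ amor1 p.
Proof.
apply: (cokerP (amap f)).2; rewrite -compmA -amor_comm compmA.
exact: is_zero_compr (cokerP (amap g)).1.
Qed.

Definition coker_mor (f g : arrow_cat M) (p : mor f g) :
    mor (coker (amap f)) (coker (amap g)) :=
  projT1 (cid (coker_mor_ex p)).

Lemma coker_mor_proj (f g : arrow_cat M) (p : mor f g) :
  coker_mor p ∘ coker_proj (amap f) = coker_proj (amap g) ∘ amor1 p.
Proof. by rewrite /coker_mor; case: cid => b [hb _] /=; exact: hb. Qed.

Lemma coker_mor_uniq (f g : arrow_cat M) (p : mor f g)
    (b : mor (coker (amap f)) (coker (amap g))) :
  b ∘ coker_proj (amap f) = coker_proj (amap g) ∘ amor1 p -> coker_mor p = b.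
Proof.
by move=> hb; rewrite /coker_mor; case: cid => c [_ hc] /=; exact: hc.
Qed.

Lemma coker_mor1 (f : arrow_cat M) :
  coker_mor (idm f) = idm (coker (amap f)).
Proof. by apply: coker_mor_uniq; rewrite comp1m [RHS]compm1. Qed.

Lemma coker_morM (f g h : arrow_cat M) (q : mor g h) (p : mor f g) :
  coker_mor (q ∘ p) = coker_mor q ∘ coker_mor p.
Proof.
apply: coker_mor_uniq.
by rewrite -compmA coker_mor_proj compmA coker_mor_proj -compmA.
Qed.

Definition coker_functor : functor (arrow_cat M) M :=
  @Functor (arrow_cat M) M (fun f => coker (amap f))
    coker_mor coker_mor1 coker_morM.

End CokernelFunctor.

(* Main.v *)
Require Import Defs.
From mathcomp Require Import all_boot all_order all_algebra.
From mathcomp Require Import reals.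
From mathcomp Require Import boolp constructive_ereal ereal.

(** A functor that does not increase the weight of any morphism sends zig-zags
    to zig-zags of no larger weight, hence is 1-Lipschitz. For direct sums,
    factor a family into families that are isomorphisms outside a single index
    [s]; the direct sum of such a family is a push-out of its [s]-component.
    For cokernels, factor [(p0, p1)] as [(p0, 1) ∘ (1, p1)]. The second factor
    induces a push-out of [p1]. The first induces a push-out of
    [coker p0 -> 0], whose weight equals that of [0 -> coker p0], which is a
    push-out of [p0]. *)

Set Implicit Arguments.
Unset Strict Implicit.
Unset Printing Implicit Defensive.

Import Order.TTheory.
Local Open Scope ereal_scope.
Local Open Scope cat_scope.

Lemma functor_lipschitz1 (R : realType) (C D : category)
    (wC : valuation R C) (wD : valuation R D) (F : functor C D) :
  (forall (X Y : C) (f : mor X Y), weight wD (fmor F f) <= weight wC f) ->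
  lipschitz1 wC wD F.
Proof.
move=> wF X Y; apply: le_ereal_inf_tmp => _ [z _ <-].
suff [z' hz'] : exists z' : zigzag (F Y) (F X),
    zigzag_weight wD z' <= zigzag_weight wC z.
  by apply: le_trans hz'; apply: ereal_inf_lbound; exists z'.
elim: z => [|X1 W X2 f g z [z' hz']]; first by exists (ZZnil _).
exists (ZZcons (fmor F f) (fmor F g) z') => /=.
by do 2?apply: leeD.
Qed.

Section ZeroAndIso.
Variable C : category.
Implicit Types X Y Z : C.

(** A zero morphism factors through any given zero object, so [f] and [g] both factor through the
    same [O], where the factors are unique. *)
Lemma is_zero_eq X Y (f g : mor X Y) : is_zero f -> is_zero g -> f = g.
Proof.
move=> f0 [O [a [b [O_zero ->]]]].
have [c [d ->]] := is_zero_through O_zero f0.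
have [u [_ u_uniq]] := O_zero.1 Y; have [v [_ v_uniq]] := O_zero.2 X.
by rewrite -(u_uniq a) // -(u_uniq c) // -(v_uniq b) // -(v_uniq d).
Qed.

Lemma is_zero_from Z X (f : mor Z X) : is_zero_object Z -> is_zero f.
Proof. by move=> Z0; exists Z, f, (idm Z); rewrite compm1. Qed.

Lemma is_zero_to X Z (f : mor X Z) : is_zero_object Z -> is_zero f.
Proof. by move=> Z0; exists Z, (idm Z), f; rewrite comp1m. Qed.

Lemma is_iso_idm X : is_iso (idm X).
Proof. by exists (idm X); rewrite comp1m. Qed.

Lemma cokernel_epi X Y Q (f : mor X Y) (q : mor Y Q) :
  is_cokernel f q -> is_epi q.
Proof.
move=> [qf0 q_univ] T a b ab.
have [|c [_ c_uniq]] := q_univ T (b ∘ q).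
  by rewrite -compmA; exact: is_zero_compl.
by rewrite -(c_uniq a) // -(c_uniq b).
Qed.

End ZeroAndIso.

Section DirectSum.
Variables (S : finType) (M : abelian_category).
Implicit Types X Y : fam_cat S M.

Lemma dsum_inj_epi X (T : M) (a b : mor (dsum X) T) :
  (forall s, a ∘ dsum_inj X s = b ∘ dsum_inj X s) -> a = b.
Proof.
move=> ab.
have [c [_ c_uniq]] := biproduct_coproduct (dsumP X) (fun s => b ∘ dsum_inj X s).
by rewrite -(c_uniq a) // -(c_uniq b).
Qed.

Lemma dsum_mor_iso X Y (f : mor X Y) :
  (forall s, is_iso (f s)) -> is_iso (dsum_mor f).
Proof.
move=> /(_ _)/cid f_iso; pose g : mor Y X := fun s => sval (f_iso s).
exists (dsum_mor g); split; rewrite -dsum_morM -dsum_mor1; congr dsum_mor.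
all: by apply: functional_extensionality_dep => s; case: (svalP (f_iso s)).
Qed.

(** A cocone [(a, b)] forces the map out of [dsum Y]: it is [a] on the summand [s], and on each
    other summand [t] it is [b ∘ dsum_inj X t] composed with the inverse of [f t]. *)
Lemma dsum_mor_pushout X Y (f : mor X Y) (s : S) :
  (forall t, t != s -> is_iso (f t)) ->
  is_pushout (f s) (dsum_mor f) (dsum_inj X s) (dsum_inj Y s).
Proof.
move=> f_iso; split=> [|T a b ab]; first by rewrite dsum_mor_inj.
(* The component at [s] has to be [a]; for a variable [t] this only typechecks after transport along
   [s = t]. *)
have /(_ _)/cid d_ex t : exists d : mor (Y t) T,
    d ∘ f t = b ∘ dsum_inj X t /\
    forall e : s = t, eq_rect s (fun t => mor (Y t) T) a t e = d.
  have [->|ts] := eqVneq t s.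
    by exists a; split=> // e; rewrite (Prop_irrelevance e erefl).
  have [g [gf fg]] := f_iso t ts.
  exists (b ∘ dsum_inj X t ∘ g); split; first by rewrite -compmA gf compm1.
  by move=> e; rewrite e eqxx in ts.
have [c [cd _]] := biproduct_coproduct (dsumP Y) (fun t => sval (d_ex t)).
have c_inj : c ∘ dsum_inj Y s = a.
  by rewrite cd -((svalP (d_ex s)).2 erefl).
exists c; split; [split=> // | move=> c' [c'a c'b]].
  apply: dsum_inj_epi => t; rewrite -compmA dsum_mor_inj compmA cd.
  exact: (svalP (d_ex t)).1.
apply: dsum_inj_epi => t; have [->|ts] := eqVneq t s; first by rewrite c_inj.
(* Inserting [f t ∘ g] makes [dsum_inj Y t] factor through [dsum_mor f], and [c' ∘ dsum_mor f] is
   known to be [b]. *)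
have [g [_ fg]] := f_iso t ts.
rewrite -[dsum_inj Y t]compm1 -fg (compmA (dsum_inj Y t)) -dsum_mor_inj.
rewrite -!compmA 2!(compmA _ (dsum_mor f)) c'b; congr (_ ∘ _).
apply: dsum_inj_epi => r; rewrite -compmA dsum_mor_inj compmA cd.
by rewrite (svalP (d_ex r)).1.
Qed.

Section Weight.
Variables (R : realType) (w : valuation R M).
Hypotheses (w_pushout : pushout_nonexpansive w)
  (w_comp : composition_subadditive w).

(** Induction on a list containing every index at which [f] may fail to be invertible. For the head
    [s], [f = g ∘ h] where [h] carries the component at [s] and [g] all the others. *)
Lemma weight_dsum_mor_seq (l : seq S) X Y (f : mor X Y) :
  (forall s, s \notin l -> is_iso (f s)) ->
  weight w (dsum_mor f) <= \sum_(s <- l) weight w (f s).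
Proof.
elim: l X Y f => [|s l IHl] X Y f f_iso.
  by rewrite big_nil weight_iso //; apply: dsum_mor_iso => s; exact: f_iso.
pose Z : fam_cat S M := fun t => if t == s then Y t else X t.
pose h : mor X Z := fun t =>
  if t == s as b return mor (X t) (if b then Y t else X t)
  then f t else idm (X t).
pose g : mor Z Y := fun t =>
  if t == s as b return mor (if b then Y t else X t) (Y t)
  then idm (Y t) else f t.
have -> : f = g ∘ h.
  apply: functional_extensionality_dep => t; rewrite /= /fam_comp /g /h /Z.
  by case: (t == s); rewrite ?comp1m ?compm1.
rewrite dsum_morM; apply: le_trans (w_comp _ _) _; rewrite big_cons.
(* Only the weights are compared: [h s] ends in [Z s], which becomes [Y s] by case analysis on
   [s == s]. *)
have -> : weight w ((g ∘ h) s) = weight w (h s).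
  rewrite /= /fam_comp /g /h /Z.
  by move: (eqxx s); case: (s == s) => // _; rewrite comp1m.
apply: leeD.
  apply: w_pushout (dsum_mor_pushout _) => t /negbTE.
  by rewrite /h /Z; case: (t == s) => // _; exact: is_iso_idm.
apply: le_trans (IHl _ _ g _) _ => [t tl|].
  move: (f_iso t); rewrite inE (negbTE tl) orbF /g /Z.
  by case: (t == s) => [_|]; [exact: is_iso_idm | exact].
(* If [s] recurs in [l], the term there is the weight of an identity, hence zero. *)
apply: lee_sum => t _; rewrite /= /fam_comp /g /h /Z.
case: (t == s); last by rewrite compm1.
by rewrite (weight_iso w (is_iso_idm _)) weight_ge0.
Qed.

Lemma weight_dsum_mor X Y (f : mor X Y) :
  weight w (dsum_mor f) <= \sum_(s : S) weight w (f s).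
Proof. by apply: weight_dsum_mor_seq => s; rewrite mem_index_enum. Qed.

End Weight.
End DirectSum.

Section Cokernel.
Variable M : abelian_category.
Local Notation O := (zero_ob M).

(** For a cocone [(a, b)], [a ∘ amap g] vanishes after composition with the epimorphism [amor0 p],
    so it is zero and [a] descends to the cokernel of [amap g]. *)
Lemma coker_mor_pushout_tgt (f g : arrow_cat M) (p : mor f g) :
  is_epi (amor0 p) ->
  is_pushout (amor1 p) (coker_mor p)
    (coker_proj (amap f)) (coker_proj (amap g)).
Proof.
move=> p0_epi; split=> [|T a b ab]; first by rewrite coker_mor_proj.
have ag0 : is_zero (a ∘ amap g).
  (* Cancelling the epimorphism needs a zero morphism to compare with. *)
  have [z z0] : exists z : mor (asrc g) T, is_zero z.
    have [u _] := (zero_obP M).1 T; have [v _] := (zero_obP M).2 (asrc g).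
    by exists (u ∘ v); exists O, u, v; split=> //; exact: zero_obP.
  rewrite (_ : a ∘ amap g = z) //; apply: p0_epi; apply: is_zero_eq.
    rewrite -compmA amor_comm compmA ab -compmA.
    by apply: is_zero_compl; exact: (cokerP _).1.
  exact: is_zero_compr.
have [c [ca c_uniq]] := (cokerP (amap g)).2 T a ag0.
exists c; split; last by move=> c' [c'a _]; exact: c_uniq.
split=> //; apply: (cokernel_epi (cokerP (amap f))).
by rewrite -compmA coker_mor_proj compmA ca.
Qed.

(** A cocone leg out of [O] is zero, so the other leg kills [f]. *)
Lemma coker_pushout (X Y : M) (f : mor X Y) (u : mor X O)
    (v : mor O (coker f)) :
  is_pushout f v u (coker_proj f).
Proof.
have O0 := zero_obP M; split=> [|T a b ab].
  apply: is_zero_eq; first exact: (cokerP f).1.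
  by apply: is_zero_compl; exact: is_zero_to.
have [|c [ca c_uniq]] := (cokerP f).2 T a.
  by rewrite ab; apply: is_zero_compl; exact: is_zero_to.
exists c; split; last by move=> c' [c'a _]; exact: c_uniq.
by split=> //; apply: is_zero_eq; exact: is_zero_from.
Qed.

(** Here [r] inverts [amor1 p], and the square exhibits [coker_mor p] as a cokernel of [u]: if
    [b ∘ u] is zero, then [b ∘ coker_proj (amap f) ∘ r] kills [amap g] and descends. *)
Lemma coker_mor_pushout_src (f g : arrow_cat M) (p : mor f g)
    (u : mor (coker (amor0 p)) (coker (amap f)))
    (v : mor (coker (amor0 p)) O) (i : mor O (coker (amap g)))
    (r : mor (atgt g) (atgt f)) :
  r ∘ amor1 p = idm _ -> amor1 p ∘ r = idm _ ->
  u ∘ coker_proj (amor0 p) = coker_proj (amap f) ∘ r ∘ amap g ->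
  is_pushout v (coker_mor p) u i.
Proof.
have O0 := zero_obP M; move=> rp pr u_proj; split=> [|T a b ab].
  apply: is_zero_eq; first by apply: is_zero_compl; exact: is_zero_to.
  rewrite (_ : _ ∘ u = i ∘ v).
    by apply: is_zero_compl; exact: is_zero_to.
  apply: (cokernel_epi (cokerP (amor0 p))); apply: is_zero_eq.
    rewrite -compmA u_proj !compmA coker_mor_proj -(compmA _ (amor1 p)) pr.
    by rewrite compm1; exact: (cokerP _).1.
  by apply: is_zero_compr; apply: is_zero_compl; exact: is_zero_to.
have [|c [cb c_uniq]] := (cokerP (amap g)).2 T (b ∘ coker_proj (amap f) ∘ r).
  rewrite -!compmA (compmA _ r) -u_proj compmA -ab -compmA.
  by apply: is_zero_compl; apply: is_zero_compr; exact: is_zero_to.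
exists c; split; [split|move=> c' [_ c'b]].
- by apply: is_zero_eq; exact: is_zero_from.
- apply: (cokernel_epi (cokerP (amap f))).
  by rewrite -compmA coker_mor_proj compmA cb -compmA rp compm1.
- by apply: c_uniq; rewrite -c'b -(compmA c') coker_mor_proj -!compmA pr compm1.
Qed.

Section Weight.
Variables (R : realType) (w : valuation R M).
Hypotheses (w_pushout : pushout_nonexpansive w)
  (w_comp : composition_subadditive w).

Lemma weight_coker_mor_src (f g : arrow_cat M) (p : mor f g) :
  is_iso (amor1 p) -> weight w (coker_mor p) <= weight w (amor0 p).
Proof.
move=> [r [rp pr]]; have O0 := zero_obP M.
have [|u [u_proj _]] := (cokerP (amor0 p)).2 _
    (coker_proj (amap f) ∘ r ∘ amap g).
  rewrite -compmA amor_comm compmA -(compmA _ r) rp compm1.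
  exact: (cokerP _).1.
have [v _] := O0.2 (coker (amor0 p)); have [i _] := O0.1 (coker (amap g)).
have [j _] := O0.1 (coker (amor0 p)); have [k _] := O0.2 (asrc f).
apply: le_trans (w_pushout (coker_mor_pushout_src v i rp pr u_proj)) _.
(* The symmetry axiom for zero morphisms reverses [v] into [j], which is a push-out of [amor0 p]. *)
rewrite (weight_zero w (is_zero_to v O0) (is_zero_from j O0)).
exact: w_pushout (coker_pushout k j).
Qed.

Lemma weight_coker_mor (f g : arrow_cat M) (p : mor f g) :
  weight w (coker_mor p) <= weight w (amor0 p) + weight w (amor1 p).
Proof.
(* The intermediate arrow is the diagonal of the square [p]: [q] is the identity on sources and [r]
   the identity on targets. *)
pose h : arrow_cat M := Arrow (amor1 p ∘ amap f).
have q_comm : amap h ∘ idm (asrc f) = amor1 p ∘ amap f by rewrite compm1.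
have r_comm : amap g ∘ amor0 p = idm (atgt g) ∘ amap h.
  by rewrite amor_comm comp1m.
pose q : mor f h := @ArrowMor _ f h _ _ q_comm.
pose r : mor h g := @ArrowMor _ h g _ _ r_comm.
have -> : p = r ∘ q by apply: arrow_mor_eq; rewrite /= ?compm1 ?comp1m.
rewrite coker_morM; apply: le_trans (w_comp _ _) _; rewrite addeC /=.
rewrite compm1 comp1m; apply: leeD.
  by apply: (weight_coker_mor_src (p := r)); exact: is_iso_idm.
apply: w_pushout (coker_mor_pushout_tgt (p := q) _) => T a b.
by rewrite !compm1.
Qed.

End Weight.
End Cokernel.

Theorem proposition2p8 (R : realType) (M : abelian_category)
  (w : valuation R M) (w_pushout : pushout_nonexpansive w)
  (w_comp : composition_subadditive w) :
  (forall (n : nat) (S : finType), #|S| = n ->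
     lipschitz1 (fam_valuation S w) w (dsum_functor S M)) /\
  lipschitz1 (arrow_valuation w) w (coker_functor M).
Proof.
split=> [n S _|]; apply: functor_lipschitz1 => X Y f.
  exact: weight_dsum_mor.
exact: weight_coker_mor.
Qed.
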